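(* Fix the current remaining support $r=(r_{k,m})$, the delay functions $\tau=(\tau_k)_{k\in\mathcal K}$, and the current integer target $\hat h$, as in the context. Then Flow LB-GPSL (described in the context) solves the problem $$\min_{q}\ T_{\mathrm{client}}(q)=\max_{k\in\mathcal K}\tau_k\Big(\sum_m q_{k,m}\Big)\quad\text{s.t.}\quad \sum_kq_{k,m}=\hat h_m\ (m\in\mathcal M),\quad 0\le q_{k,m}\le r_{k,m}\ (k\in\mathcal K,\ m\in\mathcal M),\quad q_{k,m}\in\mathbb Z .$$ No feasible assignment for the same current support and target has lower $T_{\mathrm{client}}$.
   Context: Clients $\mathcal K=\{1,\dots,K\}$, classes $\mathcal M=\{1,\dots,M\}$. $r_{k,m}\in\mathbb Z_{\ge0}$ is the unused class-$m$ support at client $k$ before the step; $R_k=\sum_m r_{k,m}$, $R_m=\sum_k r_{k,m}$, $R=\sum_m R_m\ge1$, $B_t=\min\{B,R\}$ with $B\ge1$ an integer. The target $\hat h$ is an integer vector with $\sum_m\hat h_m=B_t$ and $\hat h_m\in\{\lfloor B_tR_m/R\rfloor,\lceil B_tR_m/R\rceil\}$ for each $m$. Delay model: $\tau_k(b)=\mathbf 1\{b>0\}(a_k+c_kb^\gamma)$ is the predicted client-side time of client $k$ for a local batch of $b$ examples, where $a_k$ is a fixed batch-independent cost, $c_k$ is the coefficient of the batch-dependent cost, and $\gamma$ is a fitted exponent. Flow LB-GPSL, for the current step: 1. Form the candidate set $\mathcal L=\{a_k+c_kb^\gamma: k\in\mathcal K,\ 1\le b\le\min(B_t,R_k)\}$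 (the attainable positive completion times), remove duplicates and sort. 2. For a budget $L$ put $u_k(L)=\max\{b\in\mathbb Z_{\ge0}: b\le R_k,\ \tau_k(b)\le L\}$ and consider the network with a source, class nodes, client nodes and a sink, with an edge source$\to m$ of capacity $\hat h_m$, an edge $m\to k$ of capacity $r_{k,m}$, and an edge $k\to$ sink of capacity $u_k(L)$, for all $m\in\mathcal M$, $k\in\mathcal K$. The budget $L$ is feasible if the maximum flow value is $B_t$. By binary search over the sorted candidates, find the smallest feasible candidate $L^\star\in\mathcal L$. 3. In the network for $L^\star$, compute an integral flow of value $B_t$ of minimum cost, where each unit on the edge $k\to$ sink costs $-d_k$ and other edges cost $0$, and return $q_{k,m}=$ flow on $m\to k$. Here $d_k=\max\{N_kS^{(t)}/N_0-(N_k-R_k),0\}$, where $N_k$ is the number of examples client $k$ held at the start of the epoch, $N_0=\sum_kN_k$, and $S^{(t)}$ is the number of examples already scheduled in the epoch.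
   Formalization: The formal statement assumes a_k ≥ 0, c_k ≥ 0 and γ ≥ 0, so that every delay τ_k is nonnegative and nondecreasing; without such sign conditions (e.g. γ = −1 with c_k > 0) the algorithm can return a non-optimal assignment. *)

(* Defs.v *)
From mathcomp Require Import all_boot all_order all_algebra.
From mathcomp Require Import boolp reals exp.

Set Implicit Arguments.
Unset Strict Implicit.
Unset Printing Implicit Defensive.

Import Order.TTheory GRing.Theory Num.Theory.

Local Open Scope ring_scope.

(* Flow networks over a finite node type.  Capacities are natural numbers, a
   pair of nodes with capacity 0 being a non-edge; flows are real valued. *)

Definition is_flow (R : realType) (V : finType) (s t : V)
    (cap : V -> V -> nat) (f : V -> V -> R) : Prop :=
  (forall u v, 0 <= f u v <= (cap u v)%:R) /\
  (forall v, v != s -> v != t -> \sum_u f u v = \sum_w f v w).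

Definition flow_value (R : realType) (V : finType) (s : V)
    (f : V -> V -> R) : R :=
  \sum_v f s v - \sum_v f v s.

Definition is_max_flow_value (R : realType) (V : finType) (s t : V)
    (cap : V -> V -> nat) (x : R) : Prop :=
  (exists2 f : V -> V -> R, is_flow s t cap f & flow_value s f = x) /\
  (forall f : V -> V -> R, is_flow s t cap f -> flow_value s f <= x).

Definition integral_flow (R : realType) (V : finType)
    (f : V -> V -> R) : Prop :=
  forall u v, f u v \is a Num.int.

Definition flow_cost (R : realType) (V : finType) (w f : V -> V -> R) : R :=
  \sum_u \sum_v w u v * f u v.

Definition is_min_cost_integral_flow (R : realType) (V : finType) (s t : V)
    (cap : V -> V -> nat) (w : V -> V -> R) (x : R) (f : V -> V -> R) : Prop :=
  [/\ is_flow s t cap f, integral_flow f, flow_value s f = x &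
    forall g : V -> V -> R, is_flow s t cap g -> integral_flow g ->
      flow_value s g = x -> flow_cost w f <= flow_cost w g].

(* [bsearch P n lo hi] is the least i in [lo, hi) with P i, or hi if there is
   none, for P monotone (false then true) and fuel n >= hi - lo. *)
Fixpoint bsearch (P : nat -> bool) (n lo hi : nat) : nat :=
  if n is n'.+1 then
    if (lo < hi)%N then
      let mid := ((lo + hi) %/ 2)%N in
      if P mid then bsearch P n' lo mid else bsearch P n' mid.+1 hi
    else lo
  else lo.

Definition bsearch_seq (T : Type) (P : T -> bool) (s : seq T) : option T :=
  onth s (bsearch (fun i => if onth s i is Some x then P x else false)
            (size s) 0 (size s)).

(* K clients, M classes; [r k m] is the unused class-m support at client k. *)

Definition client_support (K M : nat) (r : 'I_K -> 'I_M -> nat) (k : 'I_K) : nat :=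
  (\sum_m r k m)%N.

Definition class_support (K M : nat) (r : 'I_K -> 'I_M -> nat) (m : 'I_M) : nat :=
  (\sum_k r k m)%N.

Definition total_support (K M : nat) (r : 'I_K -> 'I_M -> nat) : nat :=
  (\sum_m class_support r m)%N.

Definition batch_size (K M : nat) (r : 'I_K -> 'I_M -> nat) (B : nat) : nat :=
  minn B (total_support r).

Definition is_target (R : realType) (K M : nat) (r : 'I_K -> 'I_M -> nat)
    (B : nat) (h : 'I_M -> nat) : Prop :=
  (\sum_m h m)%N = batch_size r B /\
  (forall m : 'I_M,
    let x : R := (batch_size r B)%:R * (class_support r m)%:R
                 / (total_support r)%:R in
    (h m)%:Z = Num.floor x \/ (h m)%:Z = Num.ceil x).

Definition delay (R : realType) (K : nat) (a c : 'I_K -> R) (gamma : R)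
    (k : 'I_K) (b : nat) : R :=
  if (0 < b)%N then a k + c k * (b%:R `^ gamma) else 0.

Definition feasible_assignment (K M : nat) (r : 'I_K -> 'I_M -> nat)
    (h : 'I_M -> nat) (q : 'I_K -> 'I_M -> nat) : Prop :=
  (forall m, (\sum_k q k m)%N = h m) /\ (forall k m, (q k m <= r k m)%N).

(* The default value 0 of the maximum is harmless: delays are nonnegative as
   soon as the coefficients a, c are. *)
Definition T_client (R : realType) (K M : nat) (tau : 'I_K -> nat -> R)
    (q : 'I_K -> 'I_M -> nat) : R :=
  \big[Num.max/0]_(k < K) tau k (\sum_m q k m)%N.

Definition candidates (R : realType) (K M : nat) (a c : 'I_K -> R) (gamma : R)
    (r : 'I_K -> 'I_M -> nat) (B : nat) : seq R :=
  sort <=%R (undup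
    [seq a k + c k * (b%:R `^ gamma) |
       k <- enum 'I_K,
       b <- iota 1 (minn (batch_size r B) (client_support r k))]).

(* For L >= 0 the range of the maximum contains b = 0. *)
Definition client_cap (R : realType) (K M : nat) (tau : 'I_K -> nat -> R)
    (r : 'I_K -> 'I_M -> nat) (L : R) (k : 'I_K) : nat :=
  (\max_(b < (client_support r k).+1 | (tau k b <= L)%R) b)%N.

Definition node (K M : nat) : finType := (bool + ('I_M + 'I_K))%type.
Definition source (K M : nat) : node K M := inl false.
Definition sink (K M : nat) : node K M := inl true.
Definition class_node (K M : nat) (m : 'I_M) : node K M := inr (inl m).
Definition client_node (K M : nat) (k : 'I_K) : node K M := inr (inr k).

Definition network (R : realType) (K M : nat) (tau : 'I_K -> nat -> R)
    (r : 'I_K -> 'I_M -> nat) (h : 'I_M -> nat) (L : R)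
    (x y : node K M) : nat :=
  match x, y with
  | inl false, inr (inl m) => h m
  | inr (inl m), inr (inr k) => r k m
  | inr (inr k), inl true => client_cap tau r L k
  | _, _ => 0%N
  end.

Definition budget_feasible (R : realType) (K M : nat) (tau : 'I_K -> nat -> R)
    (r : 'I_K -> 'I_M -> nat) (B : nat) (h : 'I_M -> nat) (L : R) : Prop :=
  is_max_flow_value (source K M) (sink K M) (network tau r h L)
    ((batch_size r B)%:R : R).

Definition deficit (R : realType) (K M : nat) (r : 'I_K -> 'I_M -> nat)
    (N : 'I_K -> nat) (S : nat) (k : 'I_K) : R :=
  Num.max ((N k)%:R * S%:R / (\sum_j N j)%N%:R
           - ((N k)%:R - (client_support r k)%:R)) 0.

Definition edge_cost (R : realType) (K M : nat) (d : 'I_K -> R)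
    (x y : node K M) : R :=
  match x, y with
  | inr (inr k), inl true => - d k
  | _, _ => 0
  end.

Definition budget_search (R : realType) (K M : nat) (a c : 'I_K -> R)
    (gamma : R) (r : 'I_K -> 'I_M -> nat) (B : nat) (h : 'I_M -> nat) :
    option R :=
  bsearch_seq (fun L => `[< budget_feasible (delay a c gamma) r B h L >])
    (candidates a c gamma r B).

(* [flow_lb_gpsl a c gamma r B h N S q]: q is a possible output of the
   algorithm.  It is a relation because a minimum-cost flow need not be
   unique; there is no output if the search finds no feasible candidate. *)
Definition flow_lb_gpsl (R : realType) (K M : nat) (a c : 'I_K -> R)
    (gamma : R) (r : 'I_K -> 'I_M -> nat) (B : nat) (h : 'I_M -> nat)
    (N : 'I_K -> nat) (S : nat) (q : 'I_K -> 'I_M -> nat) : Prop :=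
  exists (L : R) (f : node K M -> node K M -> R),
    [/\ budget_search a c gamma r B h = Some L,
        is_min_cost_integral_flow (source K M) (sink K M)
          (network (delay a c gamma) r h L) (edge_cost (deficit R r N S))
          (batch_size r B)%:R f &
        forall k m, f (class_node K m) (client_node M k) = (q k m)%:R].

(* Main.v *)
(* A flow of value [B_t = \sum_m h m] saturates the source edges, so its values on
   the class-client edges form a fractional transport plan; conversely an
   assignment [q] with [T_client q <= L] is an integral flow of value [B_t] for the
   budget [L].  Hence, with the integrality of transport plans, a candidate [L] is
   feasible iff some assignment has [T_client <= L].  Feasibility is then monotone
   in [L], and [T_client q] is itself a candidate for every assignment [q], so the
   binary search returns the optimal value; every integral flow for that budget is
   an optimal assignment, whatever its cost. *)

Require Import Defs.
From mathcomp Require Import all_boot all_order all_algebra.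
From mathcomp Require Import boolp reals exp.
From mathcomp Require Import zify.

Set Implicit Arguments.
Unset Strict Implicit.
Unset Printing Implicit Defensive.

Import Order.TTheory GRing.Theory Num.Theory.

Local Open Scope ring_scope.

(** * Integral transport plans from a cut condition *)

Section IntegralTransport.

Local Open Scope nat_scope.

Lemma exists_sum_eq (I : finType) (f : I -> nat) (n : nat) :
  n <= \sum_i f i -> exists2 g : I -> nat, (forall i, g i <= f i) & \sum_i g i = n.
Proof.
elim: n => [|n IHn] le_n; first by exists (fun=> 0) => //; rewrite big1.
have [g le_gf sum_g] := IHn (ltnW le_n).
have [i lt_i] : exists i, g i < f i.
  apply/existsP; rewrite -[X in is_true X]negbK; apply/negP => /existsPn ge_fg.
  have : \sum_i f i <= \sum_i g i by apply: leq_sum => i _; have := ge_fg i; lia.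
  lia.
exists (fun j => g j + (j == i)).
  by move=> j; case: eqP => [->|_]; have := le_gf j; lia.
by rewrite big_split /= sum_g -(big_mkcond (pred1 i) (fun=> 1)) big_pred1_eq addn1.
Qed.

Variables (I J : finType).

(** With exactly the columns of [A] on the source side, each row [i] joins the cheaper side of the
    cut, paying either [u i] or its edges from [A]. *)
Definition cut_capacity (u : I -> nat) (r : I -> J -> nat) (A : {set J}) : nat :=
  \sum_i minn (u i) (\sum_(j in A) r i j).

Lemma sum_setUI (f : J -> nat) (A B : {set J}) :
  \sum_(j in A :|: B) f j + \sum_(j in A :&: B) f j =
  \sum_(j in A) f j + \sum_(j in B) f j.
Proof.
rewrite !(big_mkcond (fun j => j \in _)) /= -!big_split /=.
by apply: eq_bigr => j _; rewrite !inE; case: (j \in A); case: (j \in B); rewrite /= ?addn0 ?add0n.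
Qed.

(** Submodularity of a truncated modular function: [s] and [t] stand for the sums over a union and
    an intersection, [x] and [y] for those over the two sets. *)
Lemma minn_submod (u x y s t : nat) :
  s + t = x + y -> t <= x -> t <= y -> minn u s + minn u t <= minn u x + minn u y.
Proof.
move=> e tx ty; have [ux|/ltnW xu] := leqP u x.
  apply: leq_add; first exact: geq_minl.
  by have [uy|/ltnW yu] := leqP u y; rewrite geq_min ?leqnn ?ty ?orbT.
have [uy|/ltnW yu] := leqP u y; last by rewrite -e leq_add ?geq_minr.
by rewrite addnC; apply: leq_add; rewrite geq_min ?leqnn ?tx ?orbT.
Qed.

(** By submodularity, unions and intersections of tight sets are tight. Row [i] is untruncated at
    [A], [B] and [A :&: B], so a row sum over [A :|: B] above [u i] would make the inequality strict
    and break the cut condition. *)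
Lemma tight_setU (u : I -> nat) (r : I -> J -> nat) (h : J -> nat)
    (i : I) (A B : {set J}) :
  (forall C : {set J}, \sum_(j in C) h j <= cut_capacity u r C) ->
  cut_capacity u r A = \sum_(j in A) h j -> \sum_(j in A) r i j <= u i ->
  cut_capacity u r B = \sum_(j in B) h j -> \sum_(j in B) r i j <= u i ->
  cut_capacity u r (A :|: B) = \sum_(j in A :|: B) h j /\
  \sum_(j in A :|: B) r i j <= u i.
Proof.
move=> cut tA leA tB leB.
have mono (C D : {set J}) i' : C \subset D ->
    \sum_(j in C) r i' j <= \sum_(j in D) r i' j.
  move=> /subsetP sCD; rewrite !(big_mkcond (fun j => j \in _)) /=.
  by apply: leq_sum => j _; case: ifP => // /sCD ->.
have sumUI i' := sum_setUI (r i') A B.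
have sub_rest : \sum_(i' | i' != i) (minn (u i') (\sum_(j in A :|: B) r i' j) +
      minn (u i') (\sum_(j in A :&: B) r i' j)) <=
    \sum_(i' | i' != i) (minn (u i') (\sum_(j in A) r i' j) +
      minn (u i') (\sum_(j in B) r i' j)).
  by apply: leq_sum => i' _; apply: minn_submod; rewrite ?mono ?subsetIl ?subsetIr.
have leI := leq_trans (mono _ _ i (subsetIl A B)) leA.
have := cut (A :&: B); have := cut (A :|: B); have := sum_setUI h A B.
rewrite -tA -tB /cut_capacity !(bigD1 (P := predT) i) //=.
rewrite !big_split /= in sub_rest.
move: sub_rest (sumUI i); rewrite (minn_idPr leA) (minn_idPr leB) (minn_idPr leI).
move: (\sum_(i' | i' != i) _) (\sum_(i' | i' != i) _) (\sum_(i' | i' != i) _)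
  (\sum_(i' | i' != i) _) (\sum_(j in _) _) (\sum_(j in _) _) (\sum_(j in _) _)
  (\sum_(j in _) _) (\sum_(j in _) _) (\sum_(j in _) _) => *.
lia.
Qed.

(* Delete units of [r] as long as the cut condition survives.  When some row [i]
   still exceeds [u i] and no unit of it can be deleted, every [j] with
   [r i j > 0] lies in a tight set whose [i]-row fits in [u i]; such sets are
   closed under union, so the whole row fits, a contradiction. *)
Lemma integral_transport (u : I -> nat) (r : I -> J -> nat) (h : J -> nat) :
  (forall A : {set J}, \sum_(j in A) h j <= cut_capacity u r A) ->
  exists q : I -> J -> nat, [/\ forall j, \sum_i q i j = h j,
    forall i j, q i j <= r i j & forall i, \sum_j q i j <= u i].
Proof.
have [n] := ubnP (\sum_i \sum_j r i j).
elim: n r => // n IHn r lt_n cut.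
have [/forallP fits|] := boolP [forall i, \sum_j r i j <= u i].
  (* Once all rows fit, the columns decouple, and the cut condition for singletons bounds each
     demand by its column sum. *)
  have le_h j : h j <= \sum_i r i j.
    have := cut [set j]; rewrite /cut_capacity big_set1 => /leq_trans; apply.
    by apply: leq_sum => i _; rewrite big_set1 geq_minr.
  have column j : exists g : I -> nat, (forall i, g i <= r i j) /\ \sum_i g i = h j.
    by have [g ? ?] := exists_sum_eq (le_h j); exists g.
  have [q qP] := choice column.
  exists (fun i j => q j i); split=> [j|i j|i]; [by have [] := qP j|by have [] := qP j|].
  by apply: leq_trans (fits i); apply: leq_sum => j _; have [] := qP j.
rewrite negb_forall => /existsP[i]; rewrite -ltnNge => lt_u.
pose dec j0 i' j := r i' j - ((i' == i) && (j == j0)).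
(* The subtraction in [dec] is truncated, so there must be a unit to delete. *)
have sum_dec j0 (A : {set J}) i' : 0 < r i j0 ->
    \sum_(j in A) dec j0 i' j + ((i' == i) && (j0 \in A)) = \sum_(j in A) r i' j.
  move=> r_gt0; case: eqVneq => [->|ne]; last first.
    by rewrite addn0; apply: eq_bigr => j _; rewrite /dec (negbTE ne) subn0.
  case: (boolP (j0 \in A)) => j0A /=; last first.
    rewrite addn0; apply: eq_bigr => j jA; rewrite /dec.
    have /negbTE-> : j != j0 by apply: contraNneq j0A => <-.
    by rewrite andbF subn0.
  rewrite !(bigD1 j0 j0A) /= /dec !eqxx /=.
  under eq_bigr => j /andP[_ /negbTE->] do rewrite subn0.
  lia.
have [/existsP[j0 /andP[r_gt0 /forallP cut']]|] := boolP [exists j0, (0 < r i j0) &&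
    [forall A : {set J}, \sum_(j in A) h j <= cut_capacity u (dec j0) A]].
  have [|q [qh qr qu]] := IHn (dec j0) _ cut'.
    move: lt_n; rewrite !(bigD1 (P := predT) i) //=.
    have := sum_dec j0 setT i r_gt0; rewrite eqxx inE /=.
    under eq_bigl do rewrite inE.
    under [in X in _ = X -> _]eq_bigl do rewrite inE.
    have : \sum_(i' | i' != i) \sum_j dec j0 i' j <= \sum_(i' | i' != i) \sum_j r i' j.
      by apply: leq_sum => i' _; apply: leq_sum => j _; apply: leq_subr.
    lia.
  by exists q; split=> // i' j; apply: leq_trans (qr i' j) (leq_subr _ _).
rewrite negb_exists => /forallP stuck.
pose tight (A : {set J}) :=
  (cut_capacity u r A == \sum_(j in A) h j) && (\sum_(j in A) r i j <= u i).
have tight0 : tight set0.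
  rewrite /tight /cut_capacity !big_set0 leq0n andbT big1 // => i' _.
  by rewrite big_set0 minn0.
have [A /andP[/eqP tA leA] maxA] := arg_maxnP (fun A : {set J} => #|A|) tight0.
(* If the largest tight set [A] contains the support of row [i], the whole row fits, against
   [lt_u]. *)
suff out j : j \notin A -> r i j = 0.
  move: lt_u; rewrite (bigID (mem A)) /= [X in _ + X]big1 => [|j /out//].
  by rewrite addn0 ltnNge leA.
move=> jA; apply/eqP; rewrite -leqn0 leqNgt; apply/negP => r_gt0.
have := stuck j; rewrite r_gt0 /= negb_forall => /existsP[C]; rewrite -ltnNge => ltC.
(* Deleting the unit lowers only the term of row [i], by at most one. A violation at [C] thus forces
   [j \in C], equality before the deletion, and a minimum attained by the row sum. *)
have /andP[jC /andP[/eqP tC leC]] : (j \in C) && tight C.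
  have := cut C; move: ltC; rewrite /tight /cut_capacity !(bigD1 (P := predT) i) //=.
  have := sum_dec j C i r_gt0; rewrite eqxx /=.
  rewrite (eq_bigr (fun i' => minn (u i') (\sum_(j0 in C) r i' j0))); last first.
    by move=> i' /negbTE ne; have := sum_dec j C i' r_gt0; rewrite ne addn0 => ->.
  case: (j \in C); lia.
have [tU leU] := tight_setU cut tA leA tC leC.
have : #|A :|: C| <= #|A| by apply: maxA; rewrite /tight tU eqxx.
apply/negP; rewrite -ltnNge; apply: proper_card; apply/properP.
by split; [apply: subsetUl|exists j; rewrite // inE jC orbT].
Qed.

End IntegralTransport.

(** * Correctness of binary search *)

Lemma bsearchP (P : nat -> bool) (n lo hi : nat) :
  (forall i j, (i <= j < hi)%N -> P i -> P j) -> (lo <= hi)%N -> (hi - lo <= n)%N ->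
  let i := bsearch P n lo hi in
  [/\ (lo <= i <= hi)%N, (i < hi)%N -> P i &
      forall j, (lo <= j < i)%N -> ~~ P j].
Proof.
elim: n lo hi => [|n IHn] lo hi monoP le_lohi le_n /=.
  by split=> [||j]; lia.
case: ltnP => lt_lohi; last by split=> [||j]; lia.
set mid := ((lo + hi) %/ 2)%N; have mid_lt : (lo <= mid < hi)%N by rewrite /mid; lia.
case: ifPn => Pmid.
  have [|||bnd Pi notP] := IHn lo mid; try lia.
    by move=> i j ?; apply: monoP; lia.
  split=> //; first lia.
  (* The left call returns [mid] when nothing below it satisfies [P]; then [P mid] is the test just
     made. *)
  move=> ?; have [/Pi//|ge_mid] := ltnP (bsearch P n lo mid) mid.
  by have -> : bsearch P n lo mid = mid by lia.
have [|||bnd Pi notP] := IHn mid.+1 hi; try lia; first exact: monoP.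
split=> //; first lia.
move=> j j_lt; have [le_mid|gt_mid] := leqP j mid; last by apply: notP; lia.
by apply: contra Pmid; apply: monoP; lia.
Qed.

(** The member [x] satisfying [P] keeps the returned index inside [s]; it is also the default of
    [nth]. *)
Lemma bsearch_seqP (d : Order.disp_t) (T : orderType d) (P : T -> bool) (s : seq T) (x : T) :
  sorted <=%O s ->
  {in s &, forall y z, (y <= z)%O -> P y -> P z} -> x \in s -> P x ->
  exists y, [/\ bsearch_seq P s = Some y, y \in s, P y &
    {in s, forall z, P z -> (y <= z)%O}].
Proof.
move=> s_sorted monoP xs Px; rewrite /bsearch_seq.
set Q := fun i : nat => _.
have QE i : (i < size s)%N -> Q i = P (nth x s i).
  by rewrite -onthTE -(odflt_onth x) /Q; case: (onth s i).
have [||_] := @bsearchP Q (size s) 0 (size s) _ (leq0n _) _.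
- move=> i j /andP[le_ij lt_j]; rewrite !QE //; last exact: leq_ltn_trans lt_j.
  apply: monoP; rewrite ?mem_nth //; first exact: leq_ltn_trans lt_j.
  by apply: (sorted_leq_nth le_trans le_refl) => //; rewrite inE //; apply: leq_ltn_trans lt_j.
- by rewrite subn0.
set i := bsearch _ _ _ _ => Qi notQ.
have least z : z \in s -> P z -> (i <= index z s)%N.
  move=> zs Pz; rewrite leqNgt; apply/negP => lt_i.
  by have := notQ _ lt_i; rewrite QE ?index_mem // nth_index // Pz.
have lt_i : (i < size s)%N by apply: leq_ltn_trans (least x xs Px) _; rewrite index_mem.
exists (nth x s i); split; rewrite ?mem_nth //.
- by move: lt_i; rewrite -onthTE -(odflt_onth x); case: (onth s i).
- by rewrite -QE // Qi.
move=> z zs Pz; rewrite -[z in X in is_true X](nth_index x zs).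
by apply: (sorted_leq_nth le_trans le_refl) => //; rewrite ?inE ?index_mem // least.
Qed.

(** * Existence of integral flows of minimum cost *)

Lemma exists_min_cost_integral_flow (R : realType) (V : finType) (s t : V)
    (cap : V -> V -> nat) (w : V -> V -> R) (x : R) (f0 : V -> V -> R) :
  is_flow s t cap f0 -> integral_flow f0 -> flow_value s f0 = x ->
  exists f, is_min_cost_integral_flow s t cap w x f.
Proof.
move=> flow0 int0 val0.
(* A common bound on the capacities: integral flows are then coded by a finite type, on which the
   cost attains its minimum. *)
pose C := (\max_(e : V * V) cap e.1 e.2)%N.
pose flow_of (F : {ffun V * V -> 'I_C.+1}) u v : R := (F (u, v) : nat)%:R.
have flow_ofP f : is_flow s t cap f -> integral_flow f -> exists F, flow_of F = f.
  move=> [bnd _] fint.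
  have truncE u v : (Num.truncn (f u v))%:R = f u v.
    by rewrite truncnK // natrEint fint; have /andP[] := bnd u v.
  exists [ffun e => inord (Num.truncn (f e.1 e.2))]; apply/funext => u; apply/funext => v.
  rewrite /flow_of ffunE /= inordK ?truncE // ltnS.
  apply: (@leq_trans (cap u v)); last exact: (leq_bigmax (u, v)).
  by rewrite -(ler_nat R) truncE; have /andP[] := bnd u v.
pose good F := `[< is_flow s t cap (flow_of F) /\ flow_value s (flow_of F) = x >].
have [F0 F0E] := flow_ofP _ flow0 int0.
have good0 : good F0 by apply/asboolP; rewrite F0E.
have [F /asboolP[flowF valF] minF] := arg_minP (fun F => flow_cost w (flow_of F)) good0.
exists (flow_of F); split=> // [u v|g flowg intg valg]; first exact: natr_int.
have [G GE] := flow_ofP _ flowg intg; rewrite -GE; apply: minF.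
by apply/asboolP; rewrite GE.
Qed.

(** * Flows in the network and assignments *)

Section TransportNetwork.

Variables (R : realType) (K M : nat).
Implicit Types (r q : 'I_K -> 'I_M -> nat) (h : 'I_M -> nat).
Implicit Types (tau : 'I_K -> nat -> R) (L : R).

Lemma sum_node (F : node K M -> R) :
  \sum_x F x = F (source K M) + F (sink K M) +
    (\sum_m F (class_node K m) + \sum_k F (client_node M k)).
Proof. by rewrite !big_sumType /= big_bool /= (addrC (F (inl true))). Qed.

Lemma network_flow_value tau r h L (f : node K M -> node K M -> R) :
  is_flow (source K M) (sink K M) (network tau r h L) f ->
  flow_value (source K M) f = \sum_m f (source K M) (class_node K m).
Proof.
move=> [bnd _].
have f0 x y : network tau r h L x y = 0%N -> f x y = 0.
  by move=> cap0; apply/eqP; rewrite eq_le andbC; have := bnd x y; rewrite cap0.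
rewrite /flow_value [X in _ - X]big1 ?subr0 => [|x _]; last first.
  by apply: f0; case: x => [[]|[?|?]].
by rewrite sum_node !f0 // [X in _ + (_ + X)]big1 ?add0r ?addr0 // => k _; apply: f0.
Qed.

Lemma network_flow_value_le tau r h L (f : node K M -> node K M -> R) :
  is_flow (source K M) (sink K M) (network tau r h L) f ->
  flow_value (source K M) f <= (\sum_m h m)%N%:R.
Proof.
move=> ff; rewrite (network_flow_value ff) natr_sum; apply: ler_sum => m _.
by have [/(_ (source K M) (class_node K m))/andP[]] := ff.
Qed.

Lemma network_flow_transport tau r h L (f : node K M -> node K M -> R) :
  is_flow (source K M) (sink K M) (network tau r h L) f ->
  flow_value (source K M) f = (\sum_m h m)%N%:R ->
  [/\ forall k m, 0 <= f (class_node K m) (client_node M k) <= (r k m)%:R,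
      forall m, \sum_k f (class_node K m) (client_node M k) = (h m)%:R &
      forall k, \sum_m f (class_node K m) (client_node M k) <= (client_cap tau r L k)%:R].
Proof.
move=> ff; rewrite (network_flow_value ff) natr_sum => val.
have [bnd cons] := ff.
have f0 x y : network tau r h L x y = 0%N -> f x y = 0.
  by move=> cap0; apply/eqP; rewrite eq_le andbC; have := bnd x y; rewrite cap0.
have sat m : f (source K M) (class_node K m) = (h m)%:R.
  have le_h m' : f (source K M) (class_node K m') <= (h m')%:R.
    by have /andP[] := bnd (source K M) (class_node K m').
  apply/eqP; rewrite -subr_eq0 -oppr_eq0 opprB.
  (* The slacks on the source edges are nonnegative and sum to zero, so each vanishes. *)
  have /eqP : \sum_m' ((h m')%:R - f (source K M) (class_node K m')) = 0.
    by rewrite sumrB val subrr.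
  rewrite psumr_eq0 => [/allP/(_ m)|m' _]; last by rewrite subr_ge0.
  by rewrite mem_index_enum; apply.
split=> [k m|m|k]; first exact: bnd.
- have := cons (class_node K m) isT isT; rewrite !sum_node sat.
  rewrite (f0 (sink K M)) // (f0 _ (source K M)) // (f0 _ (sink K M)) //.
  rewrite [X in _ + (X + _) = _]big1 => [|? _]; last exact: f0.
  rewrite [X in _ + (_ + X) = _]big1 => [|? _]; last exact: f0.
  rewrite [X in _ = _ + (X + _)]big1 => [|? _]; last exact: f0.
  by rewrite !add0r !addr0.
- have := cons (client_node M k) isT isT; rewrite !sum_node.
  rewrite (f0 (source K M)) // (f0 (sink K M)) // (f0 _ (source K M)) //.
  rewrite [X in _ + (_ + X) = _]big1 => [|? _]; last exact: f0.
  rewrite [X in _ = _ + (X + _)]big1 => [|? _]; last exact: f0.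
  rewrite [X in _ = _ + (_ + X)]big1 => [|? _]; last exact: f0.
  by rewrite !add0r !addr0 => ->; have /andP[] := bnd (client_node M k) (sink K M).
Qed.

Definition assignment_flow h q (x y : node K M) : R :=
  match x, y with
  | inl false, inr (inl m) => (h m)%:R
  | inr (inl m), inr (inr k) => (q k m)%:R
  | inr (inr k), inl true => (\sum_m q k m)%N%:R
  | _, _ => 0
  end.

Lemma assignment_flow_integral h q : integral_flow (assignment_flow h q).
Proof.
by move=> [[]|[m|k]] [[]|[m'|k']] /=; rewrite ?natr_int ?rpred0.
Qed.

Lemma is_flow_assignment tau r h L q :
  feasible_assignment r h q -> (forall k, \sum_m q k m <= client_cap tau r L k)%N ->
  is_flow (source K M) (sink K M) (network tau r h L) (assignment_flow h q).
Proof.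
move=> [qh qr] qcap; split=> [x y|[[]|[m|k]] // _ _].
- by move: x y => [[]|[m|k]] [[]|[m'|k']] /=; rewrite ?ler0n ?ler_nat ?lexx ?qr ?qcap /= ?qr ?qcap.
- by rewrite !sum_node /= !big1_eq !addr0 !add0r -qh natr_sum.
- by rewrite !sum_node /= !big1_eq !addr0 !add0r natr_sum.
Qed.

Lemma assignment_flow_value tau r h L q :
  is_flow (source K M) (sink K M) (network tau r h L) (assignment_flow h q) ->
  flow_value (source K M) (assignment_flow h q) = (\sum_m h m)%N%:R.
Proof. by move=> ff; rewrite (network_flow_value ff) natr_sum. Qed.

(** A real flow of full value forces the cut condition, which [integral_transport] turns into an
    integral assignment. Conversely, [assignment_flow] attains the total source capacity, hence is
    maximum. *)
Lemma budget_feasibleP tau r B h L :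
  (\sum_m h m)%N = batch_size r B ->
  budget_feasible tau r B h L <->
  exists2 q, feasible_assignment r h q & forall k, (\sum_m q k m <= client_cap tau r L k)%N.
Proof.
move=> sum_h; split=> [[[f ff]]|[q fq qcap]]; last first.
  have ff := is_flow_assignment fq qcap; split; last first.
    by move=> f; rewrite -sum_h; apply: network_flow_value_le.
  by exists (assignment_flow h q); rewrite // (assignment_flow_value ff) sum_h.
rewrite -sum_h => val _; have [bnd fh fcap] := network_flow_transport ff val.
have [|q [qh qr qcap]] := @integral_transport _ _ (client_cap tau r L) r h; last by exists q.
(* The flow out of the classes in [A] meets their demand; through each client it is at most the
   client capacity and at most the capacity of the edges from [A]. *)
move=> A; rewrite -(ler_nat R) natr_sum /cut_capacity natr_sum.
under eq_bigr do rewrite -fh.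
rewrite exchange_big /=; apply: ler_sum => k _.
rewrite natr_min le_min; apply/andP; split.
  apply: le_trans (fcap k); rewrite [leRHS](bigID (fun m => m \in A)) /= lerDl.
  by apply: sumr_ge0 => m _; have /andP[] := bnd k m.
by rewrite natr_sum; apply: ler_sum => m _; have /andP[] := bnd k m.
Qed.

Lemma client_cap_ge tau r L k b :
  (b <= client_support r k)%N -> tau k b <= L -> (b <= client_cap tau r L k)%N.
Proof.
move=> le_b tauL; rewrite /client_cap -[b in X in is_true X]/(nat_of_ord (Ordinal (le_b : (b < _.+1)%N))).
exact: (@leq_bigmax_cond _ (fun b : 'I_(client_support r k).+1 => tau k b <= L)).
Qed.

End TransportNetwork.

(** * The delay model and optimality of the algorithm *)

Section Delay.

Variables (R : realType) (K M : nat) (a c : 'I_K -> R) (gamma : R).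
Hypotheses (ha : forall k, 0 <= a k) (hc : forall k, 0 <= c k) (hgamma : 0 <= gamma).
Implicit Types (r q : 'I_K -> 'I_M -> nat) (h : 'I_M -> nat).

Local Notation tau := (delay a c gamma).

Lemma delay_ge0 k b : 0 <= tau k b.
Proof. by rewrite /delay; case: ifP => // _; rewrite addr_ge0 ?mulr_ge0 ?powR_ge0. Qed.

Lemma delay_homo k : {homo tau k : b b' / (b <= b')%N >-> b <= b'}.
Proof.
move=> b b' le_b; case: (posnP b) => [->|b_gt0]; first exact: delay_ge0.
rewrite /delay b_gt0 (leq_trans b_gt0 le_b) lerD2l ler_wpM2l //.
by rewrite ge0_ler_powR ?nnegrE ?ler0n ?ler_nat.
Qed.

Lemma delay_client_cap r L k b :
  0 <= L -> (b <= client_cap tau r L k)%N -> tau k b <= L.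
Proof.
move=> L_ge0 le_b; apply: le_trans (delay_homo k le_b) _.
(* The default [0] of the maximum meets the budget because an idle client has delay 0 and [L] is
   nonnegative. *)
rewrite /client_cap; apply: (big_ind (fun b => tau k b <= L)) => // b1 b2.
by case: (leqP b1 b2).
Qed.

Lemma T_client_le r h q L : feasible_assignment r h q -> 0 <= L ->
  (forall k, \sum_m q k m <= client_cap tau r L k)%N <-> T_client tau q <= L.
Proof.
move=> [_ qr] L_ge0; split=> [qcap|/bigmax_leP[_ leL] k].
  by apply: bigmax_le => // k _; apply: delay_client_cap (qcap k).
by apply: client_cap_ge (leL k isT); apply: leq_sum.
Qed.

Lemma candidates_ge0 r B L : L \in candidates a c gamma r B -> 0 <= L.
Proof.
rewrite mem_sort mem_undup => /allpairsPdep[k [b [_ _ ->]]].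
by rewrite addr_ge0 ?mulr_ge0 ?powR_ge0.
Qed.

(** The maximum delay is attained at a client with a positive load, and that load is at most both
    the batch size and the support of the client. *)
Lemma T_client_candidate r B h q :
  (\sum_m h m)%N = batch_size r B -> (0 < batch_size r B)%N ->
  feasible_assignment r h q -> T_client tau q \in candidates a c gamma r B.
Proof.
move=> sum_h B_gt0 [qh qr].
have sum_q : (\sum_k \sum_m q k m)%N = batch_size r B.
  by rewrite exchange_big /= -sum_h; apply: eq_bigr.
have [k0 k0_gt0] : exists k, (0 < \sum_m q k m)%N.
  apply/existsP; apply: contraLR B_gt0 => /existsPn q0; rewrite -sum_q -leqNgt leqn0 sum_nat_eq0.
  by apply/forallP => k; have := q0 k; rewrite -leqNgt leqn0.
(* Candidates start at load 1, so the maximum is taken over busy clients only; idle ones have delay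
   0 and cannot exceed it. *)
have [k k_gt0 maxk] := arg_maxP (fun k => tau k (\sum_m q k m)%N)
  (k0_gt0 : (fun k => (0 < \sum_m q k m)%N) k0).
have -> : T_client tau q = a k + c k * (\sum_m q k m)%N%:R `^ gamma.
  have <- : tau k (\sum_m q k m) = a k + c k * (\sum_m q k m)%N%:R `^ gamma.
    by rewrite /delay k_gt0.
  apply/eqP; rewrite eq_le; apply/andP; split; last exact: le_bigmax.
  apply: bigmax_le => [|k' _]; first exact: delay_ge0.
  have [q0|/maxk//] := posnP (\sum_m q k' m)%N.
  by rewrite q0 [tau k' 0%N]/delay; apply: delay_ge0.
rewrite mem_sort mem_undup; apply/allpairsPdep; exists k, (\sum_m q k m)%N.
split; rewrite ?mem_enum // mem_iota k_gt0 add1n ltnS leq_min /=.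
apply/andP; split; last exact: leq_sum.
by rewrite -sum_q [leqRHS](bigD1 k) //= leq_addr.
Qed.

(** The first half keeps the second from being vacuous: the delay of any feasible assignment is a
    feasible candidate, so the search succeeds. *)
Lemma flow_lb_gpsl_correct r B h (N : 'I_K -> nat) S :
  (\sum_m h m)%N = batch_size r B -> (0 < batch_size r B)%N ->
  (exists q, feasible_assignment r h q) ->
  (exists q, flow_lb_gpsl a c gamma r B h N S q) /\
  (forall q, flow_lb_gpsl a c gamma r B h N S q ->
    feasible_assignment r h q /\
    (forall q', feasible_assignment r h q' -> T_client tau q <= T_client tau q')).
Proof.
move=> sum_h B_gt0 [q0 fq0].
have feasP L : L \in candidates a c gamma r B -> budget_feasible tau r B h L <->
    exists2 q, feasible_assignment r h q & T_client tau q <= L.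
  move=> /candidates_ge0 L_ge0; split=> [/(budget_feasibleP _ _ sum_h)[q fq qL]|[q fq qL]].
    by exists q; rewrite -?(T_client_le fq).
  by apply/(budget_feasibleP _ _ sum_h); exists q => //; apply/(T_client_le fq).
have cand q : feasible_assignment r h q -> T_client tau q \in candidates a c gamma r B.
  exact: T_client_candidate.
have feasT q : feasible_assignment r h q -> `[< budget_feasible tau r B h (T_client tau q) >].
  by move=> fq; apply/asboolP/feasP; [exact: cand|exists q].
have [||L [searchL candL feasL minL]] := bsearch_seqP
    (P := fun L => `[< budget_feasible tau r B h L >]) _ _ (cand q0 fq0) (feasT q0 fq0).
- exact: sort_le_sorted.
- move=> L L' cL cL' leL /asboolP/(feasP _ cL)[q fq qL].
  by apply/asboolP/(feasP _ cL'); exists q => //; apply: le_trans leL.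
have L_ge0 := candidates_ge0 candL.
split=> [|q [L' [f]]].
  have /asboolP/(budget_feasibleP _ _ sum_h)[q fq qcap] := feasL.
  have ff := is_flow_assignment fq qcap.
  have := assignment_flow_value ff; rewrite sum_h => valf.
  have [f minf] := exists_min_cost_integral_flow (edge_cost (deficit R r N S)) ff
    (assignment_flow_integral R h q) valf.
  have [flowf intf _ _] := minf.
  (* The flow is integral and nonnegative, so truncation recovers its values exactly. *)
  exists (fun k m => Num.truncn (f (class_node K m) (client_node M k))), L, f.
  split=> // k m; rewrite truncnK // natrEint intf.
  by have [/(_ (class_node K m) (client_node M k))/andP[]] := flowf.
rewrite /budget_search searchL => -[[<-] [flowf _ valf _] fq].
rewrite -sum_h in valf.
have [bnd fh fcap] := network_flow_transport flowf valf.
have feasq : feasible_assignment r h q.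
  split=> [m|k m]; apply/eqP.
    by rewrite -(eqr_nat R) -fh natr_sum; apply/eqP/eq_bigr => k _; rewrite fq.
  by have := bnd k m; rewrite fq ler_nat => /andP[_]; apply/eqP.
split=> // q' fq'.
(* The delay of [q'] is itself a feasible candidate, so the least one [L] lies below it. *)
apply: (@le_trans _ _ L); last by apply: minL; [exact: cand|exact: feasT].
apply/(T_client_le feasq) => // k; rewrite -(ler_nat R) natr_sum.
by under eq_bigr do rewrite -fq; apply: fcap.
Qed.

End Delay.

(** * Feasibility of the rounded target *)

(** Since the batch size is at most the total support, the proportional share of a class is at most
    its support, an integer, and so is its ceiling. *)
Lemma target_le_class_support (R : realType) (K M : nat)
    (r : 'I_K -> 'I_M -> nat) (B : nat) (h : 'I_M -> nat) m :
  is_target R r B h -> (h m <= class_support r m)%N.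
Proof.
move=> [_ /(_ m)] /=; set x := (_ / _ : R) => hm.
have le_x : x <= (class_support r m)%:R.
  rewrite /x; have [->|R_gt0] := posnP (total_support r); first by rewrite invr0 mulr0 ler0n.
  by rewrite ler_pdivrMr ?ltr0n // mulrC ler_wpM2l ?ler0n // ler_nat geq_minr.
have : Num.ceil x <= (class_support r m)%:Z by rewrite ceil_le_int.
rewrite -lez_nat; case: hm => -> //; apply: le_trans.
by rewrite -(ler_int R) (le_trans (floor_le _) (ceil_ge _)).
Qed.

Theorem proposition4 (R : realType) (K M : nat)
    (r : 'I_K -> 'I_M -> nat) (B : nat) (h : 'I_M -> nat)
    (a c : 'I_K -> R) (gamma : R) (N : 'I_K -> nat) (S : nat)
    (hR : (1 <= total_support r)%N) (hB : (1 <= B)%N)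
    (hh : is_target R r B h)
    (ha : forall k, 0 <= a k) (hc : forall k, 0 <= c k) (hgamma : 0 <= gamma) :
  (exists q : 'I_K -> 'I_M -> nat, flow_lb_gpsl a c gamma r B h N S q) /\
  (forall q : 'I_K -> 'I_M -> nat, flow_lb_gpsl a c gamma r B h N S q ->
    feasible_assignment r h q /\
    (forall q' : 'I_K -> 'I_M -> nat, feasible_assignment r h q' ->
      T_client (delay a c gamma) q <= T_client (delay a c gamma) q')).
Proof.
apply: flow_lb_gpsl_correct => //.
- by have [] := hh.
- by rewrite /batch_size leq_min hB hR.
(* Feasibility bounds no client load, so a feasible assignment is built class by class. *)
have column m : exists g : 'I_K -> nat, (forall k, g k <= r k m)%N /\ (\sum_k g k)%N = h m.
  by have [g ? ?] := exists_sum_eq (target_le_class_support m hh); exists g.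
have [g gP] := choice column.
by exists (fun k m => g m k); split=> [m|k m]; have [] := gP m.
Qed.
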